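(* Let $n\ge2$ be an integer such that $n-1$ is a prime power. Then $$\inf_{|z_1|=\cdots=|z_n|=1}\ \max_{\nu=1,\dots,n^2-n}\left|\sum_{k=1}^n z_k^\nu\right| = \sqrt{n-1},$$ where the infimum is over all $n$-tuples of unimodular complex numbers. Moreover, an $n$-tuple $(z_1,\dots,z_n)$ of unimodular complex numbers attains this value (i.e. $\max_{\nu=1,\dots,n^2-n}|\sum_k z_k^\nu|=\sqrt{n-1}$) if and only if $z_k=\alpha\, e\!\left(\frac{a_k}{n^2-n+1}\right)$ for $k=1,\dots,n$, for some complex $\alpha$ with $|\alpha|=1$ and some perfect difference set $(a_1,\ldots,a_n)$ of order $n-1$, where $e(x)=e^{2\pi i x}$.
   Context: A perfect difference set of order $q$ is a tuple of integers $(a_1,\ldots,a_{q+1})$ such that the differences $a_i-a_j$ with $i\ne j$ represent all nonzero residues modulo $q^2+q+1$. *)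

(* Defs.v *)
From HB Require Import structures.
From mathcomp Require Export all_boot all_order all_algebra.
From mathcomp Require Export complex.
From mathcomp Require Export all_classical all_reals all_analysis.
Set Implicit Arguments.
Unset Strict Implicit.
Unset Printing Implicit Defensive.
Import Order.TTheory GRing.Theory Num.Theory.
Local Open Scope ring_scope.
Local Open Scope complex_scope.

(* k = 0 is allowed, so 1 counts as a prime power. *)
Definition prime_power (m : nat) : Prop :=
  exists p k : nat, prime p /\ m = (p ^ k)%N.

(* The tuple length m is a separate parameter, constrained to be q + 1, so that
   the predicate applies to n-tuples with q = n - 1. *)
Definition perfect_difference_set (q m : nat) (a : 'I_m -> int) : Prop :=
  m = q.+1 /\
  forall r : int, ~~ ((q ^ 2 + q + 1)%N%:Z %| r)%Z ->
    exists i j : 'I_m,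
      i != j /\ (a i - a j = r %[mod (q ^ 2 + q + 1)%N%:Z])%Z.

(* The complex modulus, as an element of R: on R[i] the norm `|_| takes its
   values in R[i]. *)
Notation modulus z := (ComplexField.Normc.normc z).

(* e(x) = exp(2 pi i x), written with Euler's formula. *)
Definition cexp2pi {R : realType} (x : R) : R[i] :=
  cos (2 * pi * x) +i* sin (2 * pi * x).

Definition unimodular {R : realType} {n : nat} (z : 'I_n -> R[i]) : Prop :=
  forall k, modulus (z k) = 1.

(* The default value 0 is harmless: moduli are nonnegative, and the range of nu
   is nonempty for n >= 2. *)
Definition max_power_sum {R : realType} {n : nat} (z : 'I_n -> R[i]) : R :=
  \big[Num.max/0]_(1 <= nu < (n ^ 2 - n).+1) modulus (\sum_(k < n) z k ^+ nu).

(* Main.v *)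
Require Import Defs.
From mathcomp Require Import finfield cyclic.
From mathcomp Require Import ring lra zify.
Import Order.TTheory GRing.Theory Num.Theory.
Local Open Scope ring_scope.

(** Put [N = n^2 - n + 1], let [S_nu] be the power sums of [z], and let
    [w_kl = z_k / z_l].  Expanding squares in two ways,
      [\sum_(k, l) |\sum_(j < N) w_kl^j|^2 = \sum_(i, j < N) |S_(i-j)|^2].
    The left side is at least its diagonal [n N^2]; the right side is at most
    [N n^2 + N (N - 1) M^2], where [M] is the maximum of [|S_nu|] over
    [0 < nu < N].  Hence [M^2 >= n - 1].  In the case of equality every
    [w_kl] is an [N]-th root of unity and every [|S_nu|^2] equals [n - 1],
    and Fourier inversion modulo [N] turns the latter into the statement that
    the exponents form a perfect difference set.  Conversely, by counting, the
    differences of a perfect difference set take each nonzero residue exactly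
    once, so [|S_nu|^2 = n + (-1)].

    Perfect difference sets of prime power order [q] come from Singer's
    construction: for a generator [th] of the multiplicative group of [GF(q^3)]
    and [t] outside [GF(q)], take the logarithms to base [th] of [1] and of
    [t + c], [c] in [GF(q)].  They represent the lines of the plane
    [V = <1, t>], and [V] meets [x V] nontrivially for every [x]. *)

(** * Power sums of unimodular numbers *)

Section PowerSums.
Variable C : numClosedFieldType.
Implicit Types (n N : nat) (x w B : C).

Lemma sqr_norm_sum (I : finType) (u : I -> C) :
  `|\sum_i u i| ^+ 2 = \sum_i \sum_j u i * (u j)^*.
Proof.
by rewrite normCK rmorph_sum mulr_suml; apply: eq_bigr => i _;
  rewrite mulr_sumr.
Qed.

(** Both sides expand to the sum of [z k ^+ i * (z l)^* ^+ i * (z k)^* ^+ j * z l ^+ j] over all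
    [i], [j], [k], [l]. *)
Lemma sum_sqr_norm_geometric n N (z : 'I_n -> C) :
  \sum_k \sum_l `|\sum_(j < N) (z k * (z l)^*) ^+ j| ^+ 2 =
  \sum_(i < N) \sum_(j < N) `|\sum_k z k ^+ i * (z k)^* ^+ j| ^+ 2.
Proof.
under eq_bigr do under eq_bigr do rewrite sqr_norm_sum pair_bigA /=.
rewrite pair_bigA exchange_big [RHS]pair_bigA; apply: eq_bigr => -[i j] _ /=.
rewrite sqr_norm_sum pair_bigA; apply: eq_bigr => -[k l] _ /=.
rewrite rmorphXn !rmorphM /= !rmorphXn /= !conjCK !exprMn; ring.
Qed.

Lemma big_diag n (F : 'I_n -> 'I_n -> C) :
  \sum_i \sum_j F i j = \sum_i F i i + \sum_i \sum_(j | j != i) F i j.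
Proof.
by rewrite -big_split; apply: eq_bigr => i _; rewrite (bigD1 i).
Qed.

Lemma norm1_mul_conj x : `|x| = 1 -> x * x^* = 1.
Proof. by move=> x1; rewrite -normCK x1 expr1n. Qed.

Lemma mixed_power_sumE n (z : 'I_n -> C) (i j : nat) :
  (forall k, `|z k| = 1) -> (j <= i)%N ->
  \sum_k z k ^+ i * (z k)^* ^+ j = \sum_k z k ^+ (i - j).
Proof.
move=> z1 ji; apply: eq_bigr => k _.
by rewrite -{1}(subnK ji) exprD -mulrA -exprMn norm1_mul_conj // expr1n mulr1.
Qed.

(** The exponent is [|i - j|] in truncated subtraction; conjugation reduces [i < j] to [j <= i]. *)
Lemma norm_mixed_power_sum n (z : 'I_n -> C) (i j : nat) :
  (forall k, `|z k| = 1) ->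
  `|\sum_k z k ^+ i * (z k)^* ^+ j| = `|\sum_k z k ^+ ((i - j) + (j - i))|.
Proof.
move=> z1; have [ji|/ltnW ij] := leqP j i.
  by rewrite mixed_power_sumE // (eqP ji) addn0.
rewrite -norm_conjC rmorph_sum (eqP ij) add0n -mixed_power_sumE //.
congr `|_|; apply: eq_bigr => k _.
by rewrite rmorphM !rmorphXn /= conjCK mulrC.
Qed.

(** The two sums on the left are the slack in the two estimates of the double count. Being exact,
    the identity serves both the inequality and its equality case. *)
Lemma power_sum_defect n N (z : 'I_n -> C) B :
  (forall k, `|z k| = 1) ->
  \sum_k \sum_(l | l != k) `|\sum_(j < N) (z k * (z l)^*) ^+ j| ^+ 2 +
  \sum_(i < N) \sum_(j < N | j != i)
    (B - `|\sum_k z k ^+ ((i - j) + (j - i))| ^+ 2) =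
  N%:R * (n%:R ^+ 2 + (N%:R - 1) * B - n%:R * N%:R).
Proof.
move=> z1; have := sum_sqr_norm_geometric n N z; rewrite !big_diag.
set D := \sum_k \sum_(l | _) _; set T := \sum_(i < N) \sum_(j < N | _) _.
have -> : \sum_(k < n) `|\sum_(j < N) (z k * (z k)^*) ^+ j| ^+ 2
    = n%:R * N%:R ^+ 2.
  under eq_bigr => k _.
    rewrite norm1_mul_conj //.
    under eq_bigr do rewrite expr1n.
    rewrite sumr_const card_ord normr_nat.
    over.
  by rewrite sumr_const card_ord -[LHS]mulr_natl.
have -> : \sum_(i < N) `|\sum_k z k ^+ i * (z k)^* ^+ i| ^+ 2
    = N%:R * n%:R ^+ 2.
  under eq_bigr => i _.
    rewrite mixed_power_sumE // subnn.
    under eq_bigr do rewrite expr0.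
    rewrite sumr_const card_ord normr_nat.
    over.
  by rewrite sumr_const card_ord -[LHS]mulr_natl.
move=> E; have -> : \sum_(i < N) \sum_(j < N | j != i)
    (B - `|\sum_k z k ^+ ((i - j) + (j - i))| ^+ 2) = N%:R * (N%:R - 1) * B - T.
  apply/eqP; rewrite -subr_eq opprK; apply/eqP.
  rewrite -big_split /=; under eq_bigr => i _.
    rewrite -big_split /=.
    under eq_bigr do rewrite norm_mixed_power_sum // subrK.
    rewrite sumr_const cardC1 card_ord.
    over.
  rewrite sumr_const card_ord -(mulr_natl B) -[LHS]mulr_natl mulrA.
  (* [cardC1] leaves [N.-1], which matches [N%:R - 1] only for positive [N]; for [N = 0] the factor
     [N%:R] settles it. *)
  by case: N {D T E} => [|N]; rewrite ?mul0r // -[N.+1%:R]natr1 addrK.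
have -> : D = N%:R * n%:R ^+ 2 + T - n%:R * N%:R ^+ 2 by rewrite -E addrC addKr.
ring.
Qed.

Lemma sum_expr_unity_root N x : x ^+ N = 1 -> x != 1 -> \sum_(i < N) x ^+ i = 0.
Proof.
move=> xN x1; apply: (@mulfI _ (x - 1)); first by rewrite subr_eq0.
by rewrite -subrX1 xN subrr mulr0.
Qed.

(** * The lower bound and its equality case *)

Section Extremal.
Variables (n : nat) (z : 'I_n -> C).
Hypotheses (n2 : (2 <= n)%N) (z1 : forall k, `|z k| = 1).
Let N := (n ^ 2 - n + 1)%N.

Let NE : N%:R - 1 = n%:R * (n%:R - 1) :> C.
Proof.
rewrite /N natrD addrK natrB ?leq_pmulr 1?ltnW // natrM; ring.
Qed.

Let defect_ge0 B :
  (forall nu, (0 < nu < N)%N -> `|\sum_k z k ^+ nu| ^+ 2 <= B) ->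
  forall i j : 'I_N, j != i ->
  0 <= B - `|\sum_k z k ^+ ((i - j) + (j - i))| ^+ 2.
Proof.
move=> hB i j ij; rewrite subr_ge0 hB //.
have := ltn_ord i; have := ltn_ord j; move: ij; rewrite -val_eqE /=; lia.
Qed.

(** For [N = n(n - 1) + 1] the defect has its root at [B = n - 1], whence the extremal value. *)
Let defectE B :
  N%:R * (n%:R ^+ 2 + (N%:R - 1) * B - n%:R * N%:R)
  = (N * n * n.-1)%:R * (B - (n%:R - 1)) :> C.
Proof.
have -> : N%:R = n%:R * (n%:R - 1) + 1 :> C by rewrite -NE subrK.
rewrite 2!natrM -subn1 natrB 1?ltnW // -[N%:R](subrK 1) NE; ring.
Qed.

Lemma power_sum_lower_bound B :
  (forall nu, (0 < nu < N)%N -> `|\sum_k z k ^+ nu| ^+ 2 <= B) -> n%:R - 1 <= B.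
Proof.
move=> hB; have : 0 <= (N * n * n.-1)%:R * (B - (n%:R - 1)).
  rewrite -defectE -(power_sum_defect _ _ z) // addr_ge0 //.
    by do 2!apply: sumr_ge0 => ? _; rewrite exprn_ge0.
  by apply: sumr_ge0 => i _; apply: sumr_ge0 => j; apply: defect_ge0.
rewrite pmulr_rge0 ?subr_ge0 // ltr0n !muln_gt0 /N addn1 /=; lia.
Qed.

(** At [B = n - 1] the defect is zero, so each of its nonnegative terms vanishes. A vanishing
    geometric sum in [x] forces [x ^+ N = 1]. *)
Lemma power_sum_extremal :
  (forall nu, (0 < nu < N)%N -> `|\sum_k z k ^+ nu| ^+ 2 <= n%:R - 1) ->
  (forall k l, (z k * (z l)^*) ^+ N = 1) /\
  (forall nu, (0 < nu < N)%N -> `|\sum_k z k ^+ nu| ^+ 2 = n%:R - 1).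
Proof.
move=> hB; have /eqP := power_sum_defect _ N z (n%:R - 1) z1.
have ge0 := defect_ge0 _ hB.
have sge0 (k : 'I_n) : 0 <=
    \sum_(l | l != k) `|\sum_(j < N) (z k * (z l)^*) ^+ j| ^+ 2.
  by apply: sumr_ge0 => ? _; rewrite exprn_ge0.
have dge0 (i : 'I_N) : 0 <= \sum_(j < N | j != i)
    (n%:R - 1 - `|\sum_k z k ^+ ((i - j) + (j - i))| ^+ 2).
  by apply: sumr_ge0 => ? /ge0.
rewrite defectE subrr mulr0 paddr_eq0 ?sumr_ge0 //.
case/andP=> /eqP /psumr_eq0P h1 /eqP /psumr_eq0P h2; split.
  move=> k l; have [->|lk] := eqVneq l k.
    by rewrite norm1_mul_conj ?expr1n.
  have /eqP := psumr_eq0P (fun i _ => exprn_ge0 2 (normr_ge0 _))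
     (h1 (fun i _ => sge0 i) k isT) lk.
  rewrite expf_eq0 /= normr_eq0 => /eqP E; apply/eqP.
  by rewrite -subr_eq0 subrX1 E mulr0.
move=> nu /andP[nu0 nuN].
have N0 : (0 < N)%N by rewrite /N addn1.
(* The pair [i = nu], [j = 0] isolates the power sum of exponent [nu]. *)
have /eqP := psumr_eq0P (ge0 (Ordinal nuN))
  (h2 (fun i _ => dge0 i) (Ordinal nuN) isT)
  (negbT (ltn_eqF nu0) : Ordinal N0 != Ordinal nuN).
by rewrite /= subn0 addn0 subr_eq0 => /eqP <-.
Qed.

End Extremal.

(** * Difference sets and flat spectra modulo [N] *)

Section DifferenceSets.
Variables (n : nat) (w : C) (b : 'I_n -> nat).
Let N := (n ^ 2 - n + 1)%N.
Hypotheses (n2 : (2 <= n)%N) (w1 : `|w| = 1) (wP : N.-primitive_root w).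

Let wwc k : w ^+ k * (w ^+ k)^* = 1.
Proof. by rewrite norm1_mul_conj // normrX w1 expr1n. Qed.

Let NE : N = (n * n.-1).+1.
Proof. by rewrite /N addn1 -subn1 mulnBr muln1 mulnn. Qed.

(** By Fourier inversion, [S] is [N] times the number of pairs with [b k - b l = r] modulo [N].
    Without such a pair [S = 0], while flatness gives [S = n^2 - (n - 1) = N]. *)
Lemma flat_spectrum_difference_set :
  (forall nu, (0 < nu < N)%N -> `|\sum_k (w ^+ b k) ^+ nu| ^+ 2 = n%:R - 1) ->
  forall r, ~~ (N %| r)%N -> exists i j, b i = b j + r %[mod N].
Proof.
move=> flat r Nr.
have [/existsP[i /existsP[j /eqP ij]]|] :=
  boolP [exists i, exists j, b i == b j + r %[mod N]]; first by exists i, j.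
rewrite negb_exists => /forallP no; exfalso.
have wr1 : (w ^+ r)^* != 1 by rewrite fmorph_eq1 -(prim_order_dvd wP).
have wrN : (w ^+ r)^* ^+ N = 1.
  by rewrite -rmorphXn exprAC (prim_expr_order wP) expr1n rmorph1.
pose S := \sum_(nu < N) `|\sum_k (w ^+ b k) ^+ nu| ^+ 2 * (w ^+ r)^* ^+ nu.
have : S = 0.
  under [S]eq_bigr do rewrite sqr_norm_sum pair_bigA mulr_suml /=.
  rewrite exchange_big big1 // => -[k l] _ /=.
  have xE nu : (w ^+ b k) ^+ nu * ((w ^+ b l) ^+ nu)^* * (w ^+ r)^* ^+ nu =
      (w ^+ b k * (w ^+ b l)^* * (w ^+ r)^*) ^+ nu.
    by rewrite !exprMn rmorphXn.
  under eq_bigr do rewrite xE.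
  apply: sum_expr_unity_root.
    rewrite -xE -!exprM ![(_ * N)%N]mulnC !exprM (prim_expr_order wP) !expr1n.
    by rewrite rmorph1 wrN !mulr1.
  (* The ratio is [w] to the power [b k - b l - r]; were it 1, the pair [k], [l] would represent
     [r]. *)
  have /negP nokl := no k; apply/eqP => E; apply: nokl; apply/existsP; exists l.
  rewrite -(eq_prim_root_expr wP) exprD -[w ^+ b k]mulr1 -(wwc (b l)).
  rewrite -[X in X == _]mulr1 -(wwc r).
  rewrite -[X in _ == X]mulr1 -E; apply/eqP; ring.
rewrite {}/S; move: flat wrN (sum_expr_unity_root _ _ wrN wr1); rewrite NE.
move=> flat wrN; rewrite !big_ord_recl /= expr0 => gs.
under eq_bigr => i _ do rewrite expr0.
rewrite sumr_const card_ord normr_nat.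
rewrite (eq_bigr (fun i : 'I__ => (n%:R - 1) * (w ^+ r)^* ^+ bump 0 i));
  last first.
  by move=> i _; rewrite flat // /bump add1n /= ltnS ltn_ord.
rewrite -mulr_sumr.
have -> : \sum_(i < n * n.-1) (w ^+ r)^* ^+ bump 0 i = -1.
  by apply/eqP; rewrite -addr_eq0 addrC; apply/eqP.
have -> : n%:R ^+ 2 * 1 + (n%:R - 1) * -1 = (n * n.-1).+1%:R :> C.
  by rewrite -natr1 natrM -subn1 natrB 1?ltnW //; ring.
by move/eqP; rewrite pnatr_eq0.
Qed.

(** The residue of [b p.1 - b p.2], written so that no subtraction truncates. *)
Let diff (p : 'I_n * 'I_n) : 'I_N :=
  Ordinal (ltn_pmod (b p.1 + (N - b p.2 %% N)) (prim_order_gt0 wP)).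

Let diffP p : b p.1 = b p.2 + diff p %[mod N].
Proof.
have E : ((b p.2 + (N - b p.2 %% N)) %% N = 0)%N.
  by rewrite -modnDml subnKC ?modnn // ltnW // ltn_pmod // (prim_order_gt0 wP).
by rewrite /= modnDmr addnCA -modnDmr E addn0.
Qed.

Let diff_uniq p (r : 'I_N) : b p.1 = b p.2 + r %[mod N] -> diff p = r.
Proof.
rewrite diffP => /eqP; rewrite eqn_modDl !modn_small // => /eqP; exact: val_inj.
Qed.

Lemma difference_set_flat_spectrum :
  (forall r, ~~ (N %| r)%N -> exists i j, b i = b j + r %[mod N]) ->
  forall nu, (0 < nu < N)%N -> `|\sum_k (w ^+ b k) ^+ nu| ^+ 2 = n%:R - 1.
Proof.
move=> pds nu /andP[nu0 nuN].
pose z0 : 'I_N := Ordinal (prim_order_gt0 wP).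
(* [c] counts the pairs with a given difference and [e] is a lower bound for it: the [n] diagonal
   pairs at residue 0, one pair elsewhere. Both total [n^2 = n + (N - 1)], so they agree
   everywhere. *)
pose c (r : 'I_N) := #|[pred p | diff p == r]|.
pose e (r : 'I_N) := if r == z0 then n else 1%N.
have cE r : c r = e r.
  have le_ec i : (e i <= c i ?= iff (e i == c i))%N.
    apply/leqifP; case: eqVneq => // ec; rewrite ltn_neqAle ec /= /e.
    case: eqVneq => [->|i0].
      rewrite -[leqLHS]card_ord.
      rewrite -(fintype.card_image (f := fun k : 'I_n => (k, k))).
        apply/subset_leq_card/fintype.subsetP => _ /fintype.imageP[k _ ->].
        by rewrite inE; apply/eqP/diff_uniq; rewrite addn0.
      by move=> k l [].
    have [|k [l kl]] := pds i.
      rewrite gtnNdvd // lt0n.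
      by apply: contra i0 => /eqP i0; apply/eqP/val_inj.
    by apply/card_gt0P; exists (k, l); rewrite inE; apply/eqP/diff_uniq.
  have sE : \sum_r e r = (\sum_r c r)%N.
    have -> : (\sum_r c r)%N = #|{: 'I_n * 'I_n}|.
      rewrite -sum1_card (partition_big diff xpredT) //=.
      by apply: eq_bigr => i _; rewrite sum1_card.
    rewrite card_prod card_ord (bigD1 z0) //= /e eqxx.
    rewrite (eq_bigr (fun=> 1%N)) => [|i /negPf -> //].
    rewrite sum1_card cardC1 card_ord NE /=; lia.
  have := leqif_sum (P := xpredT) (fun i _ => le_ec i).
  by rewrite /leqif sE eqxx => -[_ /esym /forallP /(_ r) /eqP].
rewrite sqr_norm_sum pair_bigA.
rewrite (eq_bigr (fun p => (w ^+ nu) ^+ diff p)) => [|[k l] _]; last first.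
  have /eqP := diffP (k, l); rewrite -(eq_prim_root_expr wP) => /eqP /= ->.
  rewrite exprD rmorphXn exprMn mulrAC -exprMn wwc expr1n mul1r -!exprM.
  by rewrite mulnC.
rewrite (partition_big diff xpredT) //.
rewrite (eq_bigr (fun r : 'I_N => (w ^+ nu) ^+ r *+ e r)) => [|r _]; last first.
  rewrite -cE -sumr_const; apply: eq_big => [p|p /eqP -> //].
  by rewrite !inE.
have g0 : \sum_(r < N) (w ^+ nu) ^+ r = 0.
  apply: sum_expr_unity_root.
    by rewrite exprAC (prim_expr_order wP) expr1n.
  by rewrite -(prim_order_dvd wP) gtnNdvd.
(* Residue 0 contributes [n]; the others give a full geometric sum without its term 1, that is,
   -1. *)
rewrite (bigD1 z0) //= /e eqxx expr0; congr (_ + _).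
move: g0; rewrite (bigD1 z0) //= expr0 addrC => /eqP.
rewrite addr_eq0 => /eqP <-.
by apply: eq_bigr => r /negPf ->.
Qed.

End DifferenceSets.
End PowerSums.

(** * Singer difference sets *)

Lemma finField_prim_root (L : finFieldType) :
  exists t : L, (#|L|.-1).-primitive_root t.
Proof.
have c1 := card_finNzRing_gt1 L.
suff /hasP[t _ ?] : has (#|L|.-1).-primitive_root (enum (predC1 (0 : L))).
  by exists t.
apply: has_prim_root; rewrite ?enum_uniq //.
- by rewrite -ltnS prednK // ltnW.
- apply/allP => x; rewrite mem_enum inE => x0; rewrite unity_rootE.
  apply/eqP/(mulfI x0); rewrite mulr1 -exprS prednK; last exact: ltnW.
  exact: expf_card.
- by rewrite -cardE cardC1.
Qed.

Section Singer.
Variables (L : finFieldType) (p q : nat).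
Hypotheses (pL : p \in [pchar L]) (pq : p.-nat q) (q1 : (1 < q)%N).
Hypothesis cardL : #|L| = (q ^ 3)%N.
Let N := (q ^ 2 + q + 1)%N.
Variable th : L.
Hypothesis thP : (q ^ 3).-1.-primitive_root th.

(** The subfield [GF(q)], as the fixed points of a power of Frobenius. *)
Let F := [set x : L | x ^+ q == x].

Let ordE : (q ^ 3).-1 = (N * q.-1)%N.
Proof.
rewrite /N; move: q q1 => [//|m] _.
rewrite -subn1 -[m.+1.-1]/m !expnS expn0; lia.
Qed.

Let FB x y : x \in F -> y \in F -> x - y \in F.
Proof.
rewrite !inE => /eqP xF /eqP yF.
rewrite (exprDn_pchar _ _ (n := q)) ?(eq_pnat _ (pcharf_eq pL)) //.
by rewrite exprNn_pchar ?(eq_pnat _ (pcharf_eq pL)) // xF yF.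
Qed.

Let F0 : 0 \in F.
Proof. by rewrite inE expr0n; case: q q1. Qed.

Let FN x : x \in F -> - x \in F.
Proof. by rewrite -sub0r; apply: FB. Qed.

Let Fdiv x y : x \in F -> y \in F -> x / y \in F.
Proof. by rewrite !inE expr_div_n => /eqP -> /eqP ->. Qed.

Let logP x : x != 0 -> exists e, x = th ^+ e.
Proof.
move=> x0; case: (prim_rootP thP (x := x)) => [|i ->]; last by exists i.
apply: (mulfI x0); rewrite mulr1 -exprS prednK; last by rewrite expn_gt0 ltnW.
by rewrite -cardL; exact: expf_card.
Qed.

Let th0 : th != 0.
Proof.
apply: contraTneq (prim_order_gt0 thP) => th0.
apply/negP => m0; move/eqP: (prim_expr_order thP).
by rewrite th0 expr0n eqn0Ngt m0 eq_sym oner_eq0.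
Qed.

(** Follows from [q^3 - 1 = N(q - 1)]. Hence logarithms modulo [N] ignore scalars from [F] and label
    the points of the projective plane of [L] over [F]. *)
Let F_log x : x \in F -> x != 0 -> exists s, x = th ^+ (N * s).
Proof.
move=> xF x0; have [e xe] := logP _ x0; rewrite xe in xF x0 *.
have : th ^+ (e * q.-1) == 1.
  rewrite exprM; apply/eqP/(mulfI x0); rewrite mulr1 -exprS.
  rewrite prednK; last exact: ltnW.
  by apply/eqP; rewrite inE in xF.
rewrite -(prim_order_dvd thP) ordE dvdn_pmul2r;
  last by rewrite -ltnS prednK // ltnW.
by case/dvdnP=> s ->; exists s; rewrite mulnC.
Qed.

Let cardF : #|F| = q.
Proof.
have FE : F = 0 |: [set th ^+ (N * s) | s : 'I_q.-1].
  apply/setP => x; rewrite !inE; apply/idP/idP.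
    have [//|x0] := eqVneq x 0; rewrite orFb => xF.
    have [|s ->] := F_log x _ x0; first by rewrite inE.
    apply/imsetP.
    have q0 : (0 < q.-1)%N by rewrite -ltnS prednK // ltnW.
    exists (Ordinal (ltn_pmod s q0)) => //=; apply/eqP.
    by rewrite (eq_prim_root_expr thP) ordE -!muln_modr modn_mod.
  case/orP=> [/eqP->|/imsetP[s _ ->]]; first by have := F0; rewrite inE.
  rewrite -exprM; move: (nat_of_ord s) => m.
  rewrite -{1}(prednK (ltnW q1)) mulnS exprD mulnAC -ordE.
  by rewrite [X in _ * X]exprM (prim_expr_order thP) expr1n mulr1.
rewrite FE cardsU1 card_imset ?card_ord; last first.
  move=> s s' /eqP; rewrite (eq_prim_root_expr thP) ordE -!muln_modr.
  rewrite eqn_pmul2l; last by rewrite /N addn1.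
  by rewrite !modn_small // => /eqP /val_inj.
suff -> : 0 \notin [set th ^+ (N * s) | s : 'I_q.-1].
  by rewrite add1n prednK // ltnW.
by apply/imsetP => -[s _ /esym /eqP]; rewrite expf_eq0 (negPf th0) andbF.
Qed.

(** A common nonzero vector of [V] and [th^r V] equals both [th^(N s + a i)] and
    [th^(r + N s' + a j)]; comparing exponents modulo [N] represents [r]. *)
Lemma singer_log : exists a : 'I_q.+1 -> nat,
  forall r, ~~ (N %| r)%N -> exists i j, a i = a j + r %[mod N].
Proof.
have [t tF] : exists t, t \notin F.
  apply/existsP; rewrite -negb_forall; apply/negP => /forallP FT.
  have : F = [set: L] by apply/setP => x; rewrite FT inE.
  move/(congr1 (fun A : {set L} => #|A|)); rewrite cardF cardsT cardL => /eqP.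
  by rewrite -{1}(expn1 q) eqn_exp2l.
(* One vector from each of the [q + 1] one-dimensional [F]-subspaces of [V]. *)
pose reps := 1 :: [seq t + c | c <- enum F].
have srep : size reps = q.+1 by rewrite /= size_map -cardE cardF.
have tindep a b : a \in F -> b \in F -> a + b * t = 0 -> a = 0 /\ b = 0.
  move=> aF bF E; have [b0|b0] := eqVneq b 0.
    by move: E; rewrite b0 mul0r addr0.
  case/negP: tF; have -> : t = (- a) / b.
    by apply: (mulfI b0); rewrite mulrCA divff // mulr1 -[LHS](addKr a) E addr0.
  by apply: Fdiv => //; apply: FN.
have rep0 x : x \in reps -> x != 0.
  rewrite inE => /orP[/eqP->|/mapP[c]]; first exact: oner_neq0.
  rewrite mem_enum => cF ->; apply: contra tF; rewrite addr_eq0 => /eqP ->.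
  exact: FN.
have /fin_all_exists[a aP] (i : 'I_q.+1) : exists e, nth 0 reps i = th ^+ e.
  by apply/logP/rep0/mem_nth; rewrite srep.
have repP b c : b \in F -> c \in F -> b + c * t != 0 ->
    exists i s, b + c * t = th ^+ (N * s + a i).
  move=> bF cF bc0.
  suff [x [s [xr ->]]] : exists x s,
      x \in reps /\ b + c * t = th ^+ (N * s) * x.
    have xs : (index x reps < q.+1)%N by rewrite -srep index_mem.
    by exists (Ordinal xs), s; rewrite exprD -aP nth_index.
  have [c0|c0] := eqVneq c 0.
    move: bc0; rewrite c0 mul0r addr0 => /(F_log b bF)[s ->].
    by exists 1, s; rewrite mulr1 mem_head.
  (* Here the scalar [c] is factored out: [b + c t = c (t + b / c)]. *)
  have [s cs] := F_log c cF c0; exists (t + b / c), s; split.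
    by rewrite inE map_f ?orbT // mem_enum Fdiv.
  by rewrite -cs mulrDr mulrCA divff // mulr1 addrC.
(* [F^4] has more elements than [L], hence a nonzero vector of [V] in [x V]. *)
exists a => r Nr; pose x := th ^+ r.
pose f (u : (L * L) * (L * L)) := u.1.1 + u.1.2 * t - x * (u.2.1 + u.2.2 * t).
pose D := finset.setX (finset.setX F F) (finset.setX F F).
have /dinjectivePn[u uD [v /andP[vu vD] fuv]] : ~~ dinjectiveb f D.
  apply/negP => /dinjectiveP finj.
  have := max_card (mem (f @: D)); rewrite card_in_imset // !cardsX cardF cardL.
  by rewrite !mulnn -expnM leq_exp2l.
move: vu uD vD fuv; case: u v => [[u1 u2] [u3 u4]] [[v1 v2] [v3 v4]].
rewrite !finset.in_setX /f /= => vu /andP[/andP[u1F u2F] /andP[u3F u4F]].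
move=> /andP[/andP[v1F v2F] /andP[v3F v4F]] E.
have {}E : (u1 - v1) + (u2 - v2) * t = x * ((u3 - v3) + (u4 - v4) * t).
  apply/eqP; rewrite -subr_eq0; move/eqP: E; rewrite -subr_eq0 => /eqP <-.
  by apply/eqP; ring.
(* Otherwise both sides of [E] vanish, and independence of [1] and [t] makes the colliding points
   equal. *)
have w0 : (u3 - v3) + (u4 - v4) * t != 0.
  apply: contra vu => /eqP w0; move: E; rewrite w0 mulr0.
  case/tindep; rewrite ?FB // => /subr0_eq -> /subr0_eq ->.
  by case/tindep: w0; rewrite ?FB // => /subr0_eq -> /subr0_eq ->.
have v0 : (u1 - v1) + (u2 - v2) * t != 0 by rewrite E mulf_neq0 ?expf_neq0.
have [i [s Es]] := repP _ _ (FB _ _ u1F v1F) (FB _ _ u2F v2F) v0.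
have [j [s' Es']] := repP _ _ (FB _ _ u3F v3F) (FB _ _ u4F v4F) w0.
exists i, j; move: E; rewrite Es Es' -exprD => /eqP.
(* Reducing from [q^3 - 1] to its divisor [N] removes the scalar exponents [N * s] and [N * s']. *)
rewrite (eq_prim_root_expr thP) ordE => /eqP /(congr1 (modn^~ N)).
rewrite !modn_dvdm ?dvdn_mulr //.
by rewrite ![(N * _)%N]mulnC modnMDl addnCA modnMDl addnC.
Qed.
End Singer.

(** * Complex numbers over a real type *)

Local Open Scope classical_set_scope.
Local Open Scope complex_scope.

Section UnitCircle.
Variable R : realType.
Implicit Types x : R.

Lemma normc_modulus (z : R[i]) : `|z| = (modulus z)%:C.
Proof. by case: z. Qed.

Lemma modulus_ge0 (z : R[i]) : 0 <= modulus z.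
Proof. by case: z => a b; exact: sqrtr_ge0. Qed.

Lemma cexp2piD x y : cexp2pi (x + y) = cexp2pi x * cexp2pi y.
Proof.
rewrite /cexp2pi mulrDr cosD sinD; apply/eqP; rewrite eq_complex /=.
by rewrite eqxx /= addrC (mulrC (sin _) (cos _)) addrC.
Qed.

Lemma cexp2pi0 : cexp2pi (0 : R) = 1.
Proof. by rewrite /cexp2pi mulr0 cos0 sin0. Qed.

Lemma cexp2piMn x k : cexp2pi (x *+ k) = cexp2pi x ^+ k.
Proof.
elim: k => [|k IH]; first by rewrite cexp2pi0.
by rewrite mulrS cexp2piD IH exprS.
Qed.

Lemma cexp2pi1 : cexp2pi (1 : R) = 1.
Proof. by rewrite /cexp2pi mulr1 mulr_natl cos2pi sin2pi. Qed.

Lemma cexp2pi_int (m : int) : cexp2pi (m%:~R : R) = 1.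
Proof.
have nat1 (k : nat) : cexp2pi (k%:R : R) = 1.
  by rewrite cexp2piMn cexp2pi1 expr1n.
case: m => k; first exact: nat1.
rewrite NegzE mulrNz -[LHS]mulr1 -(nat1 k.+1) -cexp2piD.
by rewrite -pmulrn addNr cexp2pi0.
Qed.

Lemma modulus_cexp2pi x : modulus (cexp2pi x) = 1.
Proof. by rewrite /cexp2pi /= cos2Dsin2 sqrtr1. Qed.

(** By periodicity the multiple of [N] in [a] drops out, leaving a natural exponent as used in the
    spectral lemmas. *)
Lemma cexp2pi_div (N : nat) (a : int) : (0 < N)%N ->
  cexp2pi (a%:~R / N%:R : R) = cexp2pi N%:R^-1 ^+ `|(a %% N)%Z|%N.
Proof.
move=> N0; have N0' : N%:R != 0 :> R by rewrite pnatr_eq0 -lt0n.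
rewrite {1}(divz_eq a N) intrD mulrDl cexp2piD intrM -pmulrn mulfK //.
rewrite cexp2pi_int mul1r -cexp2piMn -[X in X%:~R]gez0_abs; last first.
  by rewrite modz_ge0 // -lt0n.
by rewrite -pmulrn mulr_natl.
Qed.

(** The real part is [1 - 2 sin^2 (pi x)], and the sine is positive. *)
Lemma cexp2pi_neq1 x : 0 < x < 1 -> cexp2pi x != 1.
Proof.
move=> /andP[x0 x1]; apply/negP => /eqP [cx _].
have s0 : 0 < sin (pi * x).
  apply: sin_gt0_pi; rewrite mulr_gt0 ?pi_gt0 //=.
  by rewrite -[ltRHS]mulr1 ltr_pM2l ?pi_gt0.
move: cx; rewrite -mulrA mulr_natl cos_mulr2n => /eqP.
have -> : cos (pi * x) ^+ 2 = 1 - sin (pi * x) ^+ 2.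
  by rewrite -(cos2Dsin2 (pi * x)) addrK.
by have : 0 < sin (pi * x) ^+ 2; [rewrite exprn_gt0|move=> h /eqP; lra].
Qed.

Lemma cexp2pi_prim_root (N : nat) :
  (0 < N)%N -> N.-primitive_root (cexp2pi (N%:R^-1 : R)).
Proof.
move=> N0; apply/andP; split=> //; apply/forallP => i; rewrite unity_rootE.
have N0' : N%:R != 0 :> R by rewrite pnatr_eq0 -lt0n.
rewrite -cexp2piMn -[_ *+ i.+1]mulr_natl; have [->|iN] := eqVneq i.+1 N.
  by rewrite divff // cexp2pi1 eqxx.
rewrite eqbF_neg cexp2pi_neq1 //.
rewrite divr_gt0 ?ltr0n //= ltr_pdivrMr ?ltr0n // mul1r ltr_nat.
by rewrite ltn_neqAle iN ltn_ord.
Qed.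

End UnitCircle.

(** * Passage between integer and natural-number difference sets *)

Section DifferenceSetResidues.
Variables (q m : nat).
Let N := (q ^ 2 + q + 1)%N.

Let N0 : N%:Z != 0.
Proof. by rewrite /N addn1. Qed.

Lemma perfect_difference_set_nat (a : 'I_m -> int) :
  perfect_difference_set q a -> forall r, ~~ (N %| r)%N ->
  exists i j, `|(a i %% N)%Z|%N = `|(a j %% N)%Z|%N + r %[mod N].
Proof.
move=> [_ pds] r Nr; have [|i [j [_ ij]]] := pds r%:Z; first by rewrite dvdzE.
exists i, j; apply/eqP.
rewrite -eqz_nat -!modz_nat PoszD !gez0_abs ?modz_ge0 //.
by rewrite modz_mod modzDml -(modzDmr (a j) r) -ij modzDmr addrC subrK.
Qed.

Lemma nat_perfect_difference_set (b : 'I_m -> nat) :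
  m = q.+1 -> (forall r, ~~ (N %| r)%N -> exists i j, b i = b j + r %[mod N]) ->
  perfect_difference_set q (fun k => (b k)%:Z).
Proof.
move=> mq pds; split=> // r Nr.
have rE : (`|(r %% N)%Z|%N)%:Z = (r %% N)%Z by rewrite gez0_abs ?modz_ge0.
have [|i [j ij]] := pds `|(r %% N)%Z|%N.
  apply: contra Nr => /eqP Nr; apply/dvdz_mod0P.
  by rewrite -modz_mod -rE modz_nat Nr.
have E : ((b i)%:Z - (b j)%:Z = r %[mod N])%Z.
  have : ((b i)%:Z = (b j)%:Z + r %[mod N])%Z.
    by rewrite -modzDmr -rE -PoszD !modz_nat ij.
  by move=> E; rewrite -modzDml E modzDml addrC addKr.
exists i, j; split=> //; apply: contra Nr => /eqP ij'.
by move: E; rewrite ij' subrr mod0z => /esym /dvdz_mod0P.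
Qed.

End DifferenceSetResidues.

Lemma perfect_difference_set_exists (n : nat) :
  (2 <= n)%N -> prime_power n.-1 ->
  exists a : 'I_n -> int, perfect_difference_set n.-1 a.
Proof.
case: n => // q; rewrite ltnS => q0 [p [k [pp qE]]]; rewrite /= in qE *.
have [b bP] : exists b : 'I_q.+1 -> nat, forall r, ~~ (q ^ 2 + q + 1 %| r)%N ->
    exists i j, b i = b j + r %[mod q ^ 2 + q + 1].
  (* For [k = 0], [q = 1] and [N = 3] lie outside Singer's construction, which assumes [1 < q]; the
     set [{0, 1}] is given directly. *)
  have [k0|k0] := posnP k.
    rewrite {}qE k0 expn0 /=; exists (fun i => i : nat) => r r3.
    have : ((r %% 3 == 1) || (r %% 3 == 2))%N by lia.
    case/orP=> /eqP r3'; [exists ord_max, ord0|exists ord0, ord_max].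
      by rewrite /= add0n r3'.
    by rewrite /= -modnDmr r3'.
  have k30 : (0 < k * 3)%N by rewrite muln_gt0 k0.
  have [L pL cL] := pPrimePowerField pp k30; rewrite expnM -qE in cL.
  have [t tP] := finField_prim_root L; rewrite cL in tP.
  apply: (singer_log _ _ _ pL _ _ cL _ tP).
    by rewrite qE pnatX pnat_id.
  by rewrite qE -(exp1n k) ltn_exp2r ?prime_gt1.
by exists (fun i => (b i)%:Z); apply: nat_perfect_difference_set.
Qed.

(** * The extremal problem over [R[i]] *)

Section MaxPowerSum.
Variables (R : realType) (n : nat).
Hypothesis n2 : (2 <= n)%N.
Let N := (n ^ 2 - n + 1)%N.
Implicit Types z : 'I_n -> R[i].

Let NE : N = (n.-1 ^ 2 + n.-1 + 1)%N.
Proof. by rewrite /N; case: n n2 => // m _; rewrite !expnS expn0 /=; lia. Qed.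

Let n1_ge0 : 0 <= n%:R - 1 :> R.
Proof. by rewrite subr_ge0 ler1n ltnW. Qed.

Let sqr_modulus (x : R[i]) : `|x| ^+ 2 = (modulus x ^+ 2)%:C.
Proof. by rewrite normc_modulus rmorphXn. Qed.

Let natC : n%:R - 1 = (n%:R - 1 : R)%:C :> R[i].
Proof. by rewrite rmorphB rmorph_nat. Qed.

Lemma unimodular_norm z : unimodular z -> forall k, `|z k| = 1.
Proof. by move=> z1 k; rewrite normc_modulus z1. Qed.

Lemma modulus_le_max_power_sum z nu : (0 < nu < N)%N ->
  modulus (\sum_(k < n) z k ^+ nu) <= max_power_sum z.
Proof.
rewrite /N addn1 => nuN.
pose F m := modulus (\sum_(k < n) z k ^+ m).
apply: (le_bigmax_seq 0 nu xpredT F) => //.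
by rewrite mem_index_iota.
Qed.

Lemma max_power_sum_ge z :
  unimodular z -> Num.sqrt (n%:R - 1) <= max_power_sum z.
Proof.
move=> z1; have M0 : 0 <= max_power_sum z.
  exact: bigmax_ge_id.
rewrite -[leRHS]ger0_norm // -sqrtr_sqr ler_sqrt ?sqr_ge0 // -lecR -natC.
apply: (power_sum_lower_bound _ _ z) => //; first exact: unimodular_norm.
move=> nu nuN; rewrite sqr_modulus lecR lerXn2r ?nnegrE ?modulus_ge0 //.
exact: modulus_le_max_power_sum.
Qed.

Lemma max_power_sum_extremal z : unimodular z ->
  max_power_sum z = Num.sqrt (n%:R - 1) ->
  exists (alpha : R[i]) (a : 'I_n -> int),
    [/\ modulus alpha = 1,
        perfect_difference_set n.-1 a
      & forall k, z k = alpha * cexp2pi ((a k)%:~R / N%:R)].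
Proof.
move=> z1 zmax; have nz1 := unimodular_norm z z1.
have N0 : (0 < N)%N by rewrite /N addn1.
pose w : R[i] := cexp2pi (N%:R^-1).
have wP : N.-primitive_root w := cexp2pi_prim_root R N N0.
have w1 : `|w| = 1 by rewrite normc_modulus modulus_cexp2pi.
have [|zN flat] := power_sum_extremal _ _ z n2 nz1.
  move=> nu nuN; rewrite sqr_modulus natC lecR -(sqr_sqrtr n1_ge0) -zmax.
  rewrite lerXn2r ?nnegrE ?modulus_ge0 ?bigmax_ge_id //.
  exact: modulus_le_max_power_sum.
(* Any index serves as base point: [z k0] becomes [alpha], and the ratios [z k / z k0] are powers of
   [w]. *)
have [k0 _] : exists k0 : 'I_n, True by exists (Ordinal n2).
have /fin_all_exists[b bP] k : exists e : nat, z k * (z k0)^*%R = w ^+ e.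
  by have [i ->] := prim_rootP wP (zN k k0); exists i.
have zE k : z k = z k0 * w ^+ b k.
  by rewrite -bP mulrCA norm1_mul_conj ?mulr1.
exists (z k0), (fun k => (b k)%:Z); split=> //; last first.
  by move=> k; rewrite zE -pmulrn mulr_natl cexp2piMn.
apply: nat_perfect_difference_set; first by rewrite prednK // ltnW.
rewrite -NE; apply: (flat_spectrum_difference_set _ _ w) => // nu nuN.
rewrite -(flat nu nuN).
have -> : \sum_k z k ^+ nu = z k0 ^+ nu * \sum_k (w ^+ b k) ^+ nu.
  by rewrite mulr_sumr; apply: eq_bigr => k _; rewrite zE exprMn.
by rewrite normrM normrX nz1 expr1n mul1r.
Qed.

Lemma max_power_sum_difference_set (alpha : R[i]) (a : 'I_n -> int) z :
  modulus alpha = 1 -> perfect_difference_set n.-1 a ->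
  (forall k, z k = alpha * cexp2pi ((a k)%:~R / N%:R)) ->
  max_power_sum z = Num.sqrt (n%:R - 1).
Proof.
move=> alpha1 pds zE; have N0 : (0 < N)%N by rewrite /N addn1.
have z1 : unimodular z.
  move=> k; rewrite zE ComplexField.Normc.normcM.
  by rewrite alpha1 modulus_cexp2pi mulr1.
(* Only the upper bound remains; it must also dominate the default value 0 of the maximum. *)
apply/eqP; rewrite eq_le max_power_sum_ge // andbT.
rewrite /max_power_sum big_seq; apply: bigmax_le; first exact: sqrtr_ge0.
move=> nu; rewrite mem_index_iota -[(_ - _).+1]addn1 -/N => nuN.
pose w : R[i] := cexp2pi (N%:R^-1).
have wP : N.-primitive_root w := cexp2pi_prim_root R N N0.
have w1 : `|w| = 1 by rewrite normc_modulus modulus_cexp2pi.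
rewrite -[leLHS]ger0_norm ?modulus_ge0 // -sqrtr_sqr ler_sqrt //.
rewrite -lecR -sqr_modulus -natC.
have := perfect_difference_set_nat _ _ a pds; rewrite -NE.
move=> /(difference_set_flat_spectrum _ _ w _ n2 w1 wP) /(_ nu nuN) <-.
rewrite le_eqVlt; apply/orP; left; apply/eqP.
have -> : \sum_k z k ^+ nu =
    alpha ^+ nu * \sum_k (w ^+ `|(a k %% N)%Z|%N) ^+ nu.
  rewrite mulr_sumr; apply: eq_bigr => k _.
  by rewrite zE cexp2pi_div // exprMn.
by rewrite normrM normrX normc_modulus alpha1 expr1n mul1r.
Qed.

End MaxPowerSum.

Theorem corollary3 (R : realType) (n : nat) (hn : (2 <= n)%N)
    (hpp : prime_power n.-1) :
  inf [set max_power_sum z | z in [set z : 'I_n -> R[i] | unimodular z]]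
    = Num.sqrt (n%:R - 1) :> R
  /\
  forall z : 'I_n -> R[i], unimodular z ->
    (max_power_sum z = Num.sqrt (n%:R - 1)
     <->
     exists (alpha : R[i]) (a : 'I_n -> int),
       [/\ modulus alpha = 1,
           perfect_difference_set n.-1 a
         & forall k : 'I_n,
             z k = alpha * cexp2pi ((a k)%:~R / (n ^ 2 - n + 1)%N%:R)]).
Proof.
split; last first.
  move=> z z1; split; first exact: max_power_sum_extremal.
  move=> [alpha [a [alpha1 pds zE]]].
  exact: max_power_sum_difference_set pds zE.
(* The prime power hypothesis supplies a tuple attaining the lower bound, so the infimum is a
   minimum. *)
have [a pds] := perfect_difference_set_exists n hn hpp.
pose z (k : 'I_n) : R[i] := cexp2pi ((a k)%:~R / (n ^ 2 - n + 1)%N%:R).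
have zmem : [set max_power_sum z | z in [set z : 'I_n -> R[i] | unimodular z]]
    (Num.sqrt (n%:R - 1)).
  exists z; first by move=> k; exact: modulus_cexp2pi.
  apply: (max_power_sum_difference_set _ _ _ 1 a) => //.
    exact: ComplexField.Normc.normc1.
  by move=> k; rewrite mul1r.
have zlb : lbound
    [set max_power_sum z | z in [set z : 'I_n -> R[i] | unimodular z]]
    (Num.sqrt (n%:R - 1)).
  by move=> _ [y y1 <-]; exact: max_power_sum_ge.
apply/eqP; rewrite eq_le; apply/andP; split.
  (* The same number witnesses that the set is bounded below and, in the next line, that it is
     nonempty. *)
  by apply: ge_inf => //; exists (Num.sqrt (n%:R - 1)).
by apply: lb_le_inf => //; exists (Num.sqrt (n%:R - 1)).
Qed.
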